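(* Let $M,m$ be coprime positive integers, $m_2\in\mathbf Z$ with $0\le m_2\le m-1$, and let $\heartsuit\in\{\mathrm{I},\mathrm{II},\mathrm{III},\mathrm{IV}\}$ and integers $(k_1,k_2)$ be in the admissible range for type $\heartsuit$ (see context). Write $N^{(\pm)}_\heartsuit(\tau,z_1,z_2,t)=\big[\widehat R^{(\pm)}\cdot\mathrm{ch}^{(\pm)}_{\ddot L(\Lambda^{(M)(m,m_2)(\heartsuit)}_{k_1,k_2})}\big](\tau,z_1,z_2,t)$ and $N^{(\pm)\mathrm{tw}}_\heartsuit=\widehat R^{(\pm)\mathrm{tw}}\cdot\mathrm{ch}^{(\pm)\mathrm{tw}}_{\ddot L(\Lambda^{(M)(m,m_2)(\heartsuit)}_{k_1,k_2})}$. Put $(c,\varepsilon)=((-1)^{m_2},\frac12)$ for the sign $+$ and $(c,\varepsilon)=(-1,0)$ for the sign $-$. Then, for both signs: Non-twisted: (i) $N^{(\pm)}_{\mathrm I}=c\,e^{\frac{2\pi im}M[t+(k_1+k_2)z_1-k_1z_2]}q^{\frac mMk_1(k_1+k_2)}\,\Phi^{[m,-m_2]}(M\tau,\ z_1+k_1\tau+\varepsilon,\ -z_2+(k_1+k_2)\tau-\varepsilon,\ 0)$; (ii) $N^{(\pm)}_{\mathrm{II}}=c\,e^{\frac{2\pi im}M[t-(k_1+k_2)z_1+k_1z_2]}q^{\frac mMk_1(k_1+k_2)}\,\Phi^{[m,-m_2]}(M\tau,\ -z_1+k_1\tau+\varepsilon,\ z_2+(k_1+k_2)\tau-\varepsilon,\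 0)$; (iii) $N^{(\pm)}_{\mathrm{III}}=c\,e^{\frac{2\pi im}M[t-(k_1+k_2)z_2+k_1z_1]}q^{\frac mMk_1(k_1+k_2)}\,\Phi^{[m,-m_2]}(M\tau,\ -z_2+k_1\tau+\varepsilon,\ z_1+(k_1+k_2)\tau-\varepsilon,\ 0)$; (iv) $N^{(\pm)}_{\mathrm{IV}}=c\,e^{\frac{2\pi im}M[t+(k_1+k_2)z_2-k_1z_1]}q^{\frac mMk_1(k_1+k_2)}\,\Phi^{[m,-m_2]}(M\tau,\ z_2+k_1\tau+\varepsilon,\ -z_1+(k_1+k_2)\tau-\varepsilon,\ 0)$. Twisted: (i) $N^{(\pm)\mathrm{tw}}_{\mathrm I}=c\,e^{\frac{2\pi im}M(t-\frac\tau4)}e^{\frac{2\pi im}M[(k_1+\frac12)z_1-(k_1+k_2-\frac12)z_2]}q^{\frac mM[k_1(k_1+k_2)+\frac12k_2]}\,\Phi^{[m,-m_2]}(M\tau,\ -z_2+(k_1+\frac12)\tau+\varepsilon,\ z_1+(k_1+k_2-\frac12)\tau-\varepsilon,\ 0)$; (ii) $N^{(\pm)\mathrm{tw}}_{\mathrm{II}}=c\,e^{\frac{2\pi im}M(t-\frac\tau4)}e^{\frac{2\pi im}M[-(k_1-\frac12)z_1+(k_1+k_2+\frac12)z_2]}q^{\frac mM[k_1(k_1+k_2)-\frac12k_2]}\,\Phi^{[m,-m_2]}(M\tau,\ z_2+(k_1-\frac12)\tau+\varepsilon,\ -z_1+(k_1+k_2+\frac12)\tau-\varepsilon,\ 0)$;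 (iii) $N^{(\pm)\mathrm{tw}}_{\mathrm{III}}=c\,e^{\frac{2\pi im}M(t-\frac\tau4)}e^{\frac{2\pi im}M[(k_1+k_2+\frac12)z_1-(k_1-\frac12)z_2]}q^{\frac mM[k_1(k_1+k_2)-\frac12k_2]}\,\Phi^{[m,-m_2]}(M\tau,\ z_1+(k_1-\frac12)\tau+\varepsilon,\ -z_2+(k_1+k_2+\frac12)\tau-\varepsilon,\ 0)$; (iv) $N^{(\pm)\mathrm{tw}}_{\mathrm{IV}}=c\,e^{\frac{2\pi im}M(t-\frac\tau4)}e^{\frac{2\pi im}M[-(k_1+k_2-\frac12)z_1+(k_1+\frac12)z_2]}q^{\frac mM[k_1(k_1+k_2)+\frac12k_2]}\,\Phi^{[m,-m_2]}(M\tau,\ -z_1+(k_1+\frac12)\tau+\varepsilon,\ z_2+(k_1+k_2-\frac12)\tau-\varepsilon,\ 0)$.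
   Context: Functions. $q=e^{2\pi i\tau}$. For $m\in\frac12\mathbf Z_{>0}$, $s\in\frac12\mathbf Z$: $\Phi^{[m,s]}_1(\tau,z_1,z_2,t)=e^{-2\pi imt}\sum_{j\in\mathbf Z}\frac{e^{2\pi imj(z_1+z_2)+2\pi isz_1}q^{mj^2+sj}}{1-e^{2\pi iz_1}q^j}$, $\Phi^{[m,s]}_2(\tau,z_1,z_2,t)=e^{-2\pi imt}\sum_{j\in\mathbf Z}\frac{e^{-2\pi imj(z_1+z_2)-2\pi isz_2}q^{mj^2+sj}}{1-e^{-2\pi iz_2}q^j}$, $\Phi^{[m,s]}=\Phi^{[m,s]}_1-\Phi^{[m,s]}_2$. Affine superalgebra. $\widehat A(1,1)$ is the affine Lie superalgebra of $sl(2|2)/\mathbf CI$ with simple roots $\alpha_0,\alpha_2$ (even), $\alpha_1,\alpha_3$ (odd), and $(\alpha_0|\alpha_0)=2$, $(\alpha_2|\alpha_2)=-2$, $(\alpha_1|\alpha_1)=(\alpha_3|\alpha_3)=(\alpha_1|\alpha_3)=(\alpha_0|\alpha_2)=0$, $(\alpha_0|\alpha_1)=(\alpha_0|\alpha_3)=-1$, $(\alpha_1|\alpha_2)=(\alpha_2|\alpha_3)=1$ (so $\alpha_1,\alpha_3$ coincide as functions on the Cartan subalgebra). $\delta=\sum_{i=0}^3\alpha_i$, $\theta=\alpha_1+\alpha_2+\alpha_3$, $(\Lambda_0|\alpha_j)=\delta_{j,0}$, $(\Lambda_0|\Lambda_0)=0$, $\rho=-\frac12(\alpha_1+\alpha_3)$,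 dual Coxeter number $0$. The Cartan subalgebra is identified with its dual via $(\cdot|\cdot)$, with coordinates $(\tau,z_1,z_2,t)=2\pi i(-\tau\Lambda_0+z+t\delta)$, $z=-\frac{z_1-z_2}2(\alpha_1+\alpha_3)-z_1\alpha_2$; thus $e^{-\alpha_1}=e^{-\alpha_3}=e^{2\pi iz_1}$, $e^{-\alpha_2}=e^{-2\pi i(z_1+z_2)}$, $e^{\Lambda_0}=e^{2\pi it}$, $e^{-\delta}=q$. Put $t_\alpha(\lambda)=\lambda+(\lambda|\delta)\alpha-\{\frac{(\alpha|\alpha)}2(\lambda|\delta)+(\lambda|\alpha)\}\delta$, $r_\theta(\lambda)=\lambda-(\lambda|\theta)\theta$, $r_{\alpha_2}(\lambda)=\lambda+(\lambda|\alpha_2)\alpha_2$, and $w.\lambda=w(\lambda+\rho)-\rho$. Characters. All characters are normalized (super)characters ($+$: character, $-$: supercharacter), $\widehat R^{(\pm)}$ is the (super)denominator, and ''numerator'' means the product $\widehat R^{(\pm)}\mathrm{ch}^{(\pm)}$. They are given by the following formulas. For $0\le m_2\le m$ let $\Lambda^{(m,m_2)}=m\Lambda_0+\frac{m_2}2(\alpha_1+\alpha_3)$ and $F^{(\pm)}=\sum_{j\in\mathbf Z}t_{j\theta}\Big(\frac{e^{\Lambda^{(m,m_2)}+\rho}}{(1\pm e^{-\alpha_1})(1\pm e^{-\alpha_3})}\Big)$; then $\widehat R^{(\pm)}\mathrm{ch}^{(\pm)}_{L(\Lambda^{(m,m_2)})}=F^{(\pm)}-r_\theta F^{(\pm)}$.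 With $\beta[b_1,b_2]:=-\frac{b_1-b_2}2(\alpha_1+\alpha_3)-b_1\alpha_2$, the types and their admissible ranges are: (I) $\overline y=1$, $\beta=\beta[k_1,-(k_1+k_2)]$, $k_1,k_2\ge0$, $2k_1+k_2\le M-1$; (II) $\overline y=r_\theta r_{\alpha_2}$, $\beta=\beta[-k_1,k_1+k_2]$, $k_1,k_2\ge1$, $2k_1+k_2\le M$; (III) $\overline y=r_{\alpha_2}$, $\beta=\beta[k_1+k_2,-k_1]$, $k_1\ge0$, $k_2\ge1$, $2k_1+k_2\le M-1$; (IV) $\overline y=r_\theta$, $\beta=\beta[-(k_1+k_2),k_1]$, $k_1\ge1$, $k_2\ge0$, $2k_1+k_2\le M$. The principal admissible weight is $\Lambda^{(M)(m,m_2)(\heartsuit)}_{k_1,k_2}=(t_\beta\overline y).(\Lambda^{(m,m_2)}-(M-1)\frac mM\Lambda_0)$ and its irreducible highest weight module has $[\widehat R^{(\pm)}\mathrm{ch}^{(\pm)}_{L(\Lambda^{(M)(m,m_2)(\heartsuit)}_{k_1,k_2})}](\tau,z,t)=[\widehat R^{(\pm)}\mathrm{ch}^{(\pm)}_{L(\Lambda^{(m,m_2)})}]\big(M\tau,\overline y^{-1}(z+\tau\beta),\frac1M(t+(z|\beta)+\frac{\tau|\beta|^2}2)\big)$. Twisted functions are $f^{\mathrm{tw}}(h)=f(w_0h)$ with $w_0=r_{\alpha_2}t_{-\frac12\alpha_2}$, i.e. $w_0(\tau,z_1,z_2,t)=(\tau,-z_2+\frac\tau2,-z_1+\frac\tau2,t+\frac{z_1+z_2}2-\frac\tau4)$.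 For $0\le m_2\le m-1$, $\ddot L(\Lambda^{(M)(m,m_2)(\heartsuit)}_{k_1,k_2})=L(\Lambda^{(M)(m,m_2)(\heartsuit)}_{k_1,k_2})\oplus L(\Lambda^{(M)(m,m_2+1)(\heartsuit)}_{k_1,k_2})$, with $\mathrm{ch}^{(\pm)}_{\ddot L}=\mathrm{ch}^{(\pm)}_{L(\Lambda^{(M)(m,m_2)(\heartsuit)}_{k_1,k_2})}\pm\mathrm{ch}^{(\pm)}_{L(\Lambda^{(M)(m,m_2+1)(\heartsuit)}_{k_1,k_2})}$ and the same for twisted characters. *)

(* Defs.v *)
From HB Require Import structures.
From mathcomp Require Import all_boot all_order all_algebra.
From mathcomp Require Import all_classical all_reals all_analysis.
From mathcomp Require Import complex.
From mathcomp Require Import ring.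
Set Implicit Arguments.
Unset Strict Implicit.
Unset Printing Implicit Defensive.
Import Order.TTheory GRing.Theory Num.Theory.
Import numFieldNormedType.Exports.
Local Open Scope classical_set_scope.
Local Open Scope ring_scope.

Definition cexp {R : realType} (x : R[i]) : R[i] :=
  let: Complex a b := x in Complex (expR a * cos b) (expR a * sin b).

Definition twopii {R : realType} : R[i] := Complex 0 (2 * pi).

(* ee x = e^(2 pi i x);  qpow tau x = q^x = e^(2 pi i tau x) *)
Definition ee {R : realType} (x : R[i]) : R[i] := cexp (twopii * x).

Definition qpow {R : realType} (tau x : R[i]) : R[i] := ee (tau * x).

(* Bilateral series: the sum over j >= 0 plus the sum over j < 0.             *)
Definition zsum {R : realType} (u : int -> R[i]) : R[i] :=
  limn (fun n : nat => \sum_(0 <= k < n) u k%:Z : R[i]^o) +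
  limn (fun n : nat => \sum_(0 <= k < n) u (- k.+1%:Z) : R[i]^o).

Lemma complex_limnE {R : realType} (u : nat -> R[i]) (l : R[i]) :
  (forall e : R[i], 0 < e -> \forall n \near \oo, `|l - u n| < e) ->
  limn (u : nat -> R[i]^o) = l.
Proof.
move=> H; apply: (@cvg_lim (R[i]^o : topologicalType) _ _ _ _ u l).
  exact: (@norm_hausdorff _ (R[i]^o)).
by apply/(@cvgrPdist_lt R[i] (R[i]^o : normedModType R[i]) _ \oo _ u l).
Qed.

Lemma zsumE {R : realType} (u : int -> R[i]) (l l' : R[i]) :
  (forall e : R[i], 0 < e ->
     \forall n \near \oo, `|l - \sum_(0 <= k < n) u k%:Z| < e) ->
  (forall e : R[i], 0 < e ->
     \forall n \near \oo, `|l' - \sum_(0 <= k < n) u (- k.+1%:Z)| < e) ->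
  zsum u = l + l'.
Proof.
by move=> /complex_limnE E /complex_limnE E'; rewrite /zsum E E'.
Qed.

(* In the applications m is in (1/2)Z_{>0} and s in (1/2)Z.                   *)
Definition Phi1 {R : realType} (m s tau z1 z2 t : R[i]) : R[i] :=
  ee (- (m * t)) *
  zsum (fun j : int =>
    ee (m * j%:~R * (z1 + z2) + s * z1) * qpow tau (m * j%:~R ^+ 2 + s * j%:~R)
    / (1 - ee z1 * qpow tau j%:~R)).

Definition Phi2 {R : realType} (m s tau z1 z2 t : R[i]) : R[i] :=
  ee (- (m * t)) *
  zsum (fun j : int =>
    ee (- (m * j%:~R * (z1 + z2)) - s * z2)
    * qpow tau (m * j%:~R ^+ 2 + s * j%:~R)
    / (1 - ee (- z2) * qpow tau j%:~R)).

Definition Phi {R : realType} (m s tau z1 z2 t : R[i]) : R[i] :=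
  Phi1 m s tau z1 z2 t - Phi2 m s tau z1 z2 t.

(* The dual of the Cartan subalgebra of A(1,1)^, identified with the Cartan   *)
(* subalgebra by the form: coordinates in the basis Lambda0, alpha0, alpha1,  *)
(* alpha2, whose Gram matrix is gram. The odd simple roots alpha1 and alpha3  *)
(* are the same function.                                                     *)
Definition cartan (R : realType) := 'rV[R[i]]_4.

Definition vec {R : realType} (a b c d : R[i]) : cartan R :=
  \row_j nth 0 [:: a; b; c; d] j.

Definition gram {R : realType} : 'M[R[i]]_4 :=
  \matrix_(i, j) nth 0 (nth [::]
    [:: [:: 0; 1;  0;  0];
        [:: 1; 2; -1;  0];
        [:: 0; -1; 0;  1];
        [:: 0; 0;  1; -2]] i) j.

Definition form {R : realType} (v w : cartan R) : R[i] :=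
  (v *m gram *m w^T) 0 0.

Definition Lambda0 {R : realType} : cartan R := vec 1 0 0 0.
Definition alpha0 {R : realType} : cartan R := vec 0 1 0 0.
Definition alpha1 {R : realType} : cartan R := vec 0 0 1 0.
Definition alpha2 {R : realType} : cartan R := vec 0 0 0 1.
Definition alpha3 {R : realType} : cartan R := alpha1.
Definition delta {R : realType} : cartan R := alpha0 + alpha1 + alpha2 + alpha3.
Definition theta {R : realType} : cartan R := alpha1 + alpha2 + alpha3.
Definition rho {R : realType} : cartan R := - (2^-1 *: (alpha1 + alpha3)).

(* fin_vec z1 z2 is the vector z of coordinates (z1, z2); it is also the      *)
(* vector written beta[z1, z2].                                               *)
Definition fin_vec {R : realType} (z1 z2 : R[i]) : cartan R :=
  - (((z1 - z2) / 2) *: (alpha1 + alpha3)) - z1 *: alpha2.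

(* The point (tau, z, t), for z in the finite part.                           *)
Definition point {R : realType} (tau : R[i]) (z : cartan R) (t : R[i]) :
  cartan R := twopii *: (- (tau *: Lambda0) + z + t *: delta).

Definition coords {R : realType} (tau z1 z2 t : R[i]) : cartan R :=
  point tau (fin_vec z1 z2) t.

(* The function e^lambda on the Cartan subalgebra. *)
Definition expw {R : realType} (lam h : cartan R) : R[i] := cexp (form lam h).

Definition transl {R : realType} (a lam : cartan R) : cartan R :=
  lam + form lam delta *: a
  - (form a a / 2 * form lam delta + form lam a) *: delta.

Definition r_theta {R : realType} (lam : cartan R) : cartan R :=
  lam - form lam theta *: theta.

Definition r_alpha2 {R : realType} (lam : cartan R) : cartan R :=
  lam + form lam alpha2 *: alpha2.

Definition dot {R : realType} (w : cartan R -> cartan R) (lam : cartan R) :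
  cartan R := w (lam + rho) - rho.

Definition w0 {R : realType} (h : cartan R) : cartan R :=
  r_alpha2 (transl (- (2^-1 *: alpha2)) h).

Definition tw {R : realType} (f : cartan R -> R[i]) (h : cartan R) : R[i] :=
  f (w0 h).

(* Plus: characters and denominators; Minus: super ones. *)
Variant chsign := Plus | Minus.

Definition sg {R : realType} (s : chsign) : R[i] :=
  match s with Plus => 1 | Minus => -1 end.

Definition Lam {R : realType} (m m2 : nat) : cartan R :=
  m%:R *: Lambda0 + (m2%:R / 2) *: (alpha1 + alpha3).

Definition Fterm {R : realType} (s : chsign) (m m2 : nat) (h : cartan R) :
  R[i] :=
  expw (Lam m m2 + rho) h
  / ((1 + sg s * expw (- alpha1) h) * (1 + sg s * expw (- alpha3) h)).

(* A Weyl group element w acts on functions by (w f) h = f (w^-1 h), so that  *)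
(* w (e^lambda) = e^(w lambda); the inverse of t_(j theta) is t_(- j theta)   *)
(* and r_theta is its own inverse.                                            *)
Definition Fsum {R : realType} (s : chsign) (m m2 : nat) (h : cartan R) :
  R[i] := zsum (fun j : int => Fterm s m m2 (transl (- (j%:~R *: theta)) h)).

Definition numer {R : realType} (s : chsign) (m m2 : nat) (h : cartan R) :
  R[i] := Fsum s m m2 h - Fsum s m m2 (r_theta h).

Variant adm_type := TypeI | TypeII | TypeIII | TypeIV.

Definition ybar {R : realType} (ty : adm_type) : cartan R -> cartan R :=
  match ty with
  | TypeI => id
  | TypeII => r_theta \o r_alpha2
  | TypeIII => r_alpha2
  | TypeIV => r_theta
  end.

Definition ybar_inv {R : realType} (ty : adm_type) : cartan R -> cartan R :=
  match ty with
  | TypeI => id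
  | TypeII => r_alpha2 \o r_theta
  | TypeIII => r_alpha2
  | TypeIV => r_theta
  end.

Definition beta {R : realType} (ty : adm_type) (k1 k2 : nat) : cartan R :=
  match ty with
  | TypeI => fin_vec k1%:R (- (k1%:R + k2%:R))
  | TypeII => fin_vec (- k1%:R) (k1%:R + k2%:R)
  | TypeIII => fin_vec (k1%:R + k2%:R) (- k1%:R)
  | TypeIV => fin_vec (- (k1%:R + k2%:R)) k1%:R
  end.

Definition admissible (ty : adm_type) (M k1 k2 : nat) : bool :=
  match ty with
  | TypeI => 2 * k1 + k2 <= M - 1
  | TypeII => [&& 1 <= k1, 1 <= k2 & 2 * k1 + k2 <= M]
  | TypeIII => (1 <= k2) && (2 * k1 + k2 <= M - 1)
  | TypeIV => (1 <= k1) && (2 * k1 + k2 <= M)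
  end%N.

Definition adm_weight {R : realType} (ty : adm_type) (M m m2 k1 k2 : nat) :
  cartan R :=
  dot (transl (beta ty k1 k2) \o ybar ty)
      (Lam m m2 - ((M%:R - 1) * (m%:R / M%:R)) *: Lambda0).

Definition adm_point {R : realType} (ty : adm_type) (M k1 k2 : nat)
    (tau : R[i]) (z : cartan R) (t : R[i]) : cartan R :=
  let b := beta ty k1 k2 in
  point (M%:R * tau) (ybar_inv ty (z + tau *: b))
        (M%:R^-1 * (t + form z b + tau * form b b / 2)).

(* The points of the domain Re delta(h) > 0 off the hyperplanes where some    *)
(* factor of the (super)denominator, attached to a real root, vanishes. The   *)
(* real roots are, up to sign, alpha2 + n delta, theta + n delta (even) and   *)
(* alpha1 + n delta, alpha1 + alpha2 + n delta (odd). Products and identities *)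
(* of meromorphic functions are evaluated at such points only.                *)
Definition regular {R : realType} (s : chsign) (h : cartan R) : Prop :=
  0 < complex.Re (form delta h) /\
  forall n : int,
    [/\ 1 - expw (- (alpha2 + n%:~R *: delta)) h != 0,
        1 - expw (- (theta + n%:~R *: delta)) h != 0,
        1 + sg s * expw (- (alpha1 + n%:~R *: delta)) h != 0 &
        1 + sg s * expw (- (alpha1 + alpha2 + n%:~R *: delta)) h != 0].

(* Den s is the normalized (super)denominator and ch s lam the normalized     *)
(* (super)character of L(lam). The modules themselves are not constructed:    *)
(* all that is used of Den and ch are the following character formulas.       *)
Definition character_formulas {R : realType}
    (Den : chsign -> cartan R -> R[i])
    (ch : chsign -> cartan R -> cartan R -> R[i]) : Prop :=
  (forall (s : chsign) (m m2 : nat) (h : cartan R),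
     (0 < m)%N -> (m2 <= m)%N -> regular s h ->
     Den s h * ch s (Lam m m2) h = numer s m m2 h) /\
  (forall (s : chsign) (M m m2 : nat) (ty : adm_type) (k1 k2 : nat)
          (tau z1 z2 t : R[i]),
     (0 < M)%N -> (0 < m)%N -> coprime M m -> (m2 <= m)%N ->
     admissible ty M k1 k2 -> regular s (coords tau z1 z2 t) ->
     let h := coords tau z1 z2 t in
     let h' := adm_point ty M k1 k2 tau (fin_vec z1 z2) t in
     Den s h * ch s (adm_weight ty M m m2 k1 k2) h =
     Den s h' * ch s (Lam m m2) h').

(* The (super)character of L-double-dot, and its twisted version. *)
Definition ch_ddot {R : realType}
    (ch : chsign -> cartan R -> cartan R -> R[i]) (s : chsign)
    (ty : adm_type) (M m m2 k1 k2 : nat) (h : cartan R) : R[i] :=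
  ch s (adm_weight ty M m m2 k1 k2) h
  + sg s * ch s (adm_weight ty M m m2.+1 k1 k2) h.

Definition ch_ddot_tw {R : realType}
    (ch : chsign -> cartan R -> cartan R -> R[i]) (s : chsign)
    (ty : adm_type) (M m m2 k1 k2 : nat) (h : cartan R) : R[i] :=
  tw (ch s (adm_weight ty M m m2 k1 k2)) h
  + sg s * tw (ch s (adm_weight ty M m m2.+1 k1 k2)) h.

Definition csign {R : realType} (s : chsign) (m2 : nat) : R[i] :=
  match s with Plus => (-1) ^+ m2 | Minus => -1 end.

Definition eps {R : realType} (s : chsign) : R[i] :=
  match s with Plus => 2^-1 | Minus => 0 end.

Lemma formE {R : realType} (a b c d a' b' c' d' : R[i]) :
  form (vec a b c d) (vec a' b' c' d') =
  a * b' + b * a' + 2 * (b * b') - b * c' - c * b' + c * d' + d * c'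
  - 2 * (d * d').
Proof.
rewrite /form !mxE !big_ord_recl big_ord0 !mxE !big_ord_recl !big_ord0 !mxE /=.
by ring.
Qed.

Lemma vec_add {R : realType} (a b c d a' b' c' d' : R[i]) :
  vec a b c d + vec a' b' c' d' = vec (a + a') (b + b') (c + c') (d + d').
Proof.
by apply/rowP => -[[|[|[|[|j]]]] lt_j] //; rewrite !mxE.
Qed.

Lemma vec_opp {R : realType} (a b c d : R[i]) :
  - vec a b c d = vec (- a) (- b) (- c) (- d).
Proof.
by apply/rowP => -[[|[|[|[|j]]]] lt_j] //; rewrite !mxE.
Qed.

Lemma vec_scale {R : realType} (x a b c d : R[i]) :
  x *: vec a b c d = vec (x * a) (x * b) (x * c) (x * d).
Proof.
by apply/rowP => -[[|[|[|[|j]]]] lt_j] //; rewrite !mxE.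
Qed.

Lemma vecP {R : realType} (h : cartan R) :
  exists a b c d : R[i], h = vec a b c d.
Proof.
exists (h 0 0), (h 0 1), (h 0 2), (h 0 3).
apply/rowP => -[[|[|[|[|j]]]] lt_j] //; rewrite !mxE /=;
  by congr (h _ _); apply: val_inj.
Qed.

Lemma coordsE {R : realType} (tau z1 z2 t : R[i]) (h := coords tau z1 z2 t) :
  [/\ expw Lambda0 h = ee t, expw (- delta) h = ee tau,
      expw (- alpha1) h = ee z1, expw (- alpha3) h = ee z1 &
      expw (- alpha2) h = ee (- (z1 + z2))].
Proof.
rewrite /h /coords /point /fin_vec /expw /ee /delta /alpha3 /Lambda0 /alpha0.
rewrite /alpha1 /alpha2.
rewrite !(vec_add, vec_scale, vec_opp, formE).
by split; congr cexp; field.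
Qed.

Lemma w0_coords {R : realType} (tau z1 z2 t : R[i]) :
  w0 (coords tau z1 z2 t) =
  coords tau (- z2 + tau / 2) (- z1 + tau / 2) (t + (z1 + z2) / 2 - tau / 4).
Proof.
rewrite /w0 /r_alpha2 /transl /coords /point /fin_vec /delta /alpha3 /Lambda0.
rewrite /alpha0 /alpha1 /alpha2.
rewrite !(vec_add, vec_scale, vec_opp, formE).
by congr vec; field.
Qed.

Lemma ybar_invK {R : realType} (ty : adm_type) :
  cancel (@ybar_inv R ty) (@ybar R ty).
Proof.
have t2 : involutive (@r_theta R).
  move=> h; have [a [b [c [d ->]]]] := vecP h.
  rewrite /r_theta /theta /alpha3 /alpha1 /alpha2.
  rewrite !(vec_add, vec_scale, vec_opp, formE).
  by congr vec; ring.
have a2 : involutive (@r_alpha2 R).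
  move=> h; have [a [b [c [d ->]]]] := vecP h.
  rewrite /r_alpha2 /alpha2 !(vec_add, vec_scale, vec_opp, formE).
  by congr vec; ring.
by case: ty => h //=; rewrite ?a2 ?t2.
Qed.

(* Main.v *)
Require Import Defs.
From HB Require Import structures.
From mathcomp Require Import all_boot all_order all_algebra.
From mathcomp Require Import all_classical all_reals all_analysis.
From mathcomp Require Import complex.
From mathcomp Require Import ring lra.
Set Implicit Arguments.
Unset Strict Implicit.
Unset Printing Implicit Defensive.
Import Order.TTheory GRing.Theory Num.Theory.
Import numFieldNormedType.Exports.
Import Normc.
Local Open Scope classical_set_scope.
Local Open Scope ring_scope.

(** The modules enter through two formulas: the numerator of
    L(Lambda^(m,m2)) is [F - r_theta F], where [F] sums over the translations
    by multiples of theta, and the numerator for an admissible weight is the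
    same function at the point [adm_point].

    The heart of the proof is the cancellation [Fsum_ddot]. The function [F] for
    [m2] is a series with denominators [(1 +- e^(2 pi i z1) q^j)^2], a square
    because alpha1 and alpha3 agree on the Cartan subalgebra. The numerators for
    [m2] and [m2 + 1] are in the ratio [e^(2 pi i z1) q^j], so that
    [F] for [m2], plus or minus [F] for [m2 + 1], has in each term the factor
    [1 +- e^(2 pi i z1) q^j] in its numerator. One power of the denominator
    cancels and the series [Phi1] with [s = - m2] is left. The sign of
    the denominator of [Phi1] is fixed, so that for the plus sign the arguments
    are shifted by one half, which costs the factor [(-1)^m2]. The
    reflection [r_theta] exchanges [z1] and [z2] and turns [Phi1] into [Phi2],
    which gives [numer_ddot].

    These series are added, rescaled and reindexed, so that they have to
    converge ([theta_summable]): the factor [q^(m j^2)] is stronger than the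
    exponential growth of all the others, and the denominators are bounded
    away from 0 for large [|j|].

    Finally, [adm_point] is computed in coordinates ([adm_point_coords]): the
    four types differ only by the action of [ybar] on [(z1, z2)]. This
    point is again regular ([regular_adm_point]), because the shifts involved
    are integral multiples of [tau] and the Weyl group permutes the walls. The
    twisted formulas are the untwisted ones at the point [w0 h]. *)

(** * The function [ee] and the modulus *)

Lemma cexpD (R : realType) (x y : R[i]) : cexp (x + y) = cexp x * cexp y.
Proof.
case: x y => [a b] [c d]; rewrite /cexp /= expRD cosD sinD.
by apply/eqP; rewrite eq_complex /=; apply/andP; split; apply/eqP; ring.
Qed.

Lemma eeD (R : realType) (x y : R[i]) : ee (x + y) = ee x * ee y.
Proof. by rewrite /ee mulrDr cexpD. Qed.

Lemma ee0 (R : realType) : ee (0 : R[i]) = 1.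
Proof. by rewrite /ee mulr0 /cexp /= expR0 cos0 sin0 mulr0 mulr1. Qed.

Lemma eeK (R : realType) (x : R[i]) : ee (- x) * ee x = 1.
Proof. by rewrite -eeD addNr ee0. Qed.

Lemma ee_neq0 (R : realType) (x : R[i]) : ee x != 0.
Proof.
by apply/eqP => e0; have := eeK x; rewrite e0 mulr0 => /esym/eqP; rewrite oner_eq0.
Qed.

Lemma eeN (R : realType) (x : R[i]) : ee (- x) = (ee x)^-1.
Proof. by apply: (mulIf (ee_neq0 x)); rewrite eeK mulVf ?ee_neq0. Qed.

Lemma ee_nat (R : realType) (x : R[i]) (n : nat) : ee (x * n%:R) = ee x ^+ n.
Proof.
elim: n => [|n IH]; first by rewrite mulr0 ee0 expr0.
by rewrite -natr1 mulrDr mulr1 eeD IH exprSr.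
Qed.

Lemma ee_int (R : realType) (x : R[i]) (j : int) : ee (x * j%:~R) = ee x ^ j.
Proof.
case: j => n; first exact: ee_nat.
by rewrite NegzE mulrNz mulrN eeN -pmulrn ee_nat.
Qed.

Lemma ee_half (R : realType) : ee (2^-1 : R[i]) = -1.
Proof.
rewrite /ee /twopii.
have -> : Complex 0 (2 * pi) / 2 = Complex 0 pi :> R[i].
  apply: (mulIf (_ : 2 != 0)); rewrite ?pnatr_eq0 // mulfVK ?pnatr_eq0 //.
  by apply/eqP; rewrite eq_complex /=; apply/andP; split; apply/eqP; ring.
rewrite /cexp expR0 cospi sinpi.
by apply/eqP; rewrite eq_complex /=; apply/andP; split; apply/eqP; ring.
Qed.

Lemma normc_ee (R : realType) (x : R[i]) :
  normc (ee x) = expR (- (2 * pi * complex.Im x)).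
Proof.
case: x => a b; rewrite /ee /twopii /cexp /=.
rewrite !mul0r !exprMn -mulrDr cos2Dsin2 mulr1 sqrtr_sqr sub0r.
by rewrite ger0_norm ?expR_ge0.
Qed.

Lemma normcX (R : rcfType) (x : R[i]) n : normc (x ^+ n) = normc x ^+ n.
Proof. by elim: n => [|n IH]; rewrite ?normc1 // !exprS normcM IH. Qed.

Lemma normc_ge0 (R : rcfType) (x : R[i]) : 0 <= normc x.
Proof. by case: x => a b; exact: sqrtr_ge0. Qed.

Lemma normc_gt0 (R : rcfType) (x : R[i]) : x != 0 -> 0 < normc x.
Proof.
by move=> x0; rewrite lt_neqAle normc_ge0 andbT eq_sym; apply: contra x0 =>
  /eqP /eq0_normc ->.
Qed.

Lemma normc_ReIm (R : rcfType) (x : R[i]) :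
  [/\ `|complex.Re x| <= normc x, `|complex.Im x| <= normc x &
      normc x <= `|complex.Re x| + `|complex.Im x|].
Proof.
case: x => a b /=; split.
- by rewrite -sqrtr_sqr ler_wsqrtr // lerDl sqr_ge0.
- by rewrite -sqrtr_sqr ler_wsqrtr // lerDr sqr_ge0.
rewrite -(@ler_sqr _ (Num.sqrt _)) ?nnegrE ?sqrtr_ge0 ?addr_ge0 //.
rewrite sqr_sqrtr ?addr_ge0 ?sqr_ge0 // sqrrD !real_normK ?num_real //.
by have := mulr_ge0 (normr_ge0 a) (normr_ge0 b); lra.
Qed.

(** * Absolutely convergent complex series *)

(** Completeness of [R[i]], in the only form used below: it is inherited from
    the real line through the real and imaginary parts. *)
Lemma cvg_complex (R : realType) (u : nat -> R[i]) :
  cvgn (fun n => complex.Re (u n)) -> cvgn (fun n => complex.Im (u n)) ->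
  cvgn (u : nat -> R[i]^o).
Proof.
move=> /cvg_ex[/= a ca] /cvg_ex[/= b cb]; apply/cvg_ex; exists (Complex a b).
apply/(@cvgrPdist_lt R[i] (R[i]^o : normedModType R[i]) _ \oo _ u) => e.
rewrite ltcE /= => /andP[/eqP ime ree].
have e2 : 0 < complex.Re e / 2 by rewrite divr_gt0.
move/cvgrPdist_lt: ca => /(_ _ e2) ca; move/cvgrPdist_lt: cb => /(_ _ e2) cb.
near=> n; have dR : `|a - complex.Re (u n)| < complex.Re e / 2 by near: n.
have dI : `|b - complex.Im (u n)| < complex.Re e / 2 by near: n.
rewrite ltcE; apply/andP; split; first by rewrite /= ime.
have [_ _] := normc_ReIm (Complex a b - u n).
move=> /le_lt_trans; apply; rewrite [ltRHS]splitr.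
by apply: ltrD; [move: dR | move: dI]; case: (u n).
Unshelve. all: by end_near.
Qed.

Lemma Re_sum (R : realType) (u : nat -> R[i]) n :
  complex.Re (\sum_(0 <= k < n) u k) = \sum_(0 <= k < n) complex.Re (u k).
Proof. exact: (raddf_sum (@complex.Re R : Rcomplex R -> R)). Qed.

Lemma Im_sum (R : realType) (u : nat -> R[i]) n :
  complex.Im (\sum_(0 <= k < n) u k) = \sum_(0 <= k < n) complex.Im (u k).
Proof. exact: (raddf_sum (@complex.Im R : Rcomplex R -> R)). Qed.

(** Replacing the finitely many terms that escape the bound by zero changes no
    tail, and the new series is dominated by a geometric one. *)
Lemma cvg_series_half_bounded (R : realType) (v : nat -> R) (C : R) :
  (\forall n \near \oo, `|v n| <= C * 2^-1 ^+ n) -> cvgn (series v).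
Proof.
case=> N _ Hv.
rewrite -(is_cvg_series_restrict N).
pose w n := if (N <= n)%N then v n else 0.
have -> : (fun n => \sum_(N <= k < n) v k) = (fun n => \sum_(N <= k < n) w k).
  apply/funext => n; apply: eq_big_nat => k /andP[Nk _].
  by rewrite /w Nk.
rewrite (is_cvg_series_restrict N); apply: normed_cvg => /=.
have half1 : `|2^-1 : R| < 1 by rewrite ger0_norm ?invr_ge0 // invf_lt1 ?ltr1n.
apply: (@series_le_cvg _ _ (geometric `|C| 2^-1)) => //.
- by move=> n /=.
- by move=> n /=; rewrite mulr_ge0 // exprn_ge0 // invr_ge0.
- move=> n /=; rewrite /w; case: ifP => [Nn|_]; last first.
    by rewrite normr0; apply: mulr_ge0 => //; rewrite exprn_ge0 // invr_ge0.
  apply: le_trans (Hv n Nn) _.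
  by rewrite ler_wpM2r ?ler_norm // exprn_ge0 // invr_ge0.
- exact: is_cvg_geometric_series.
Qed.

Lemma cvg_csum_half_bounded (R : realType) (u : nat -> R[i]) (C : R) :
  (\forall n \near \oo, normc (u n) <= C * 2^-1 ^+ n) ->
  cvgn (fun n => \sum_(0 <= k < n) u k : R[i]^o).
Proof.
move=> Hu; apply: cvg_complex.
- under eq_fun do rewrite Re_sum.
  apply: (@cvg_series_half_bounded _ _ C); apply: filterS Hu => n.
  by apply: le_trans; case: (normc_ReIm (u n)).
- under eq_fun do rewrite Im_sum.
  apply: (@cvg_series_half_bounded _ _ C); apply: filterS Hu => n.
  by apply: le_trans; case: (normc_ReIm (u n)).
Qed.

(** * Bilateral series *)

(** [zsum] adds the values of two limits, so it obeys the laws of a sum only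
    when both limits exist. *)
Definition zsummable (R : realType) (u : int -> R[i]) : Prop :=
  cvgn (fun n : nat => \sum_(0 <= k < n) u k%:Z : R[i]^o) /\
  cvgn (fun n : nat => \sum_(0 <= k < n) u (- k.+1%:Z) : R[i]^o).

Lemma clim_eq (R : realType) (u : nat -> R[i]^o) (l : R[i]^o) :
  u @ \oo --> l -> limn u = l.
Proof. by apply: cvg_lim; exact: (@norm_hausdorff _ (R[i]^o)). Qed.

Lemma zsum_linear (R : realType) (a : R[i]) (u v : int -> R[i]) :
  zsummable u -> zsummable v ->
  zsum (fun j => u j + a * v j) = zsum u + a * zsum v.
Proof.
move=> [u1 u2] [v1 v2]; rewrite /zsum.
have lin (x y : nat -> R[i]) : cvgn (fun n => \sum_(0 <= k < n) x k : R[i]^o) ->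
    cvgn (fun n => \sum_(0 <= k < n) y k : R[i]^o) ->
    limn (fun n => \sum_(0 <= k < n) (x k + a * y k) : R[i]^o) =
    limn (fun n => \sum_(0 <= k < n) x k : R[i]^o)
    + a * limn (fun n => \sum_(0 <= k < n) y k : R[i]^o).
  move=> cx cy; apply: clim_eq.
  under eq_fun do rewrite big_split /= -mulr_sumr.
  apply: (@cvgD R[i] (R[i]^o)) cx _.
  exact: (@cvgZl_tmp R[i] (R[i]^o)) cy.
by rewrite !lin //; ring.
Qed.

Lemma zsumZ (R : realType) (a : R[i]) (u : int -> R[i]) :
  zsummable u -> zsum (fun j => a * u j) = a * zsum u.
Proof.
move=> su; have -> : (fun j => a * u j) = (fun j => u j + (a - 1) * u j).
  by apply/funext => j; ring.
by rewrite zsum_linear //; ring.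
Qed.

(** The halves of the series of [u (- j)] are those of the series of [u] with
    the index 0 moved from one half to the other. *)
Lemma zsum_opp (R : realType) (u : int -> R[i]) :
  zsummable u -> zsum (fun j => u (- j)) = zsum u.
Proof.
move=> [c1 c2]; rewrite {1}/zsum.
have -> : limn (fun n => \sum_(0 <= k < n) u (- k%:Z) : R[i]^o) =
    u 0 + limn (fun n : nat => \sum_(0 <= k < n) u (- k.+1%:Z) : R[i]^o).
  apply: clim_eq; rewrite -cvg_shiftS /=.
  under eq_fun do rewrite big_nat_recl // oppr0.
  exact: (@cvgD R[i] (R[i]^o) _ _ _ _ _ _ _ (cvg_cst _) c2).
have -> : limn (fun n => \sum_(0 <= k < n) u (- (- k.+1%:Z)) : R[i]^o) =
    limn (fun n : nat => \sum_(0 <= k < n) u k%:Z : R[i]^o) - u 0.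
  apply: clim_eq; under eq_fun do under eq_bigr do rewrite opprK.
  have := c1; rewrite -cvg_shiftS => c1'.
  have -> : (fun n => \sum_(0 <= k < n) u k.+1%:Z : R[i]^o) =
     (fun n => (\sum_(0 <= k < n.+1) u k%:Z : R[i]^o) - u 0).
    by apply/funext => n; rewrite big_nat_recl //= addrAC subrr add0r.
  exact: (@cvgB R[i] (R[i]^o) _ _ _ _ _ _ _ c1' (cvg_cst _)).
by rewrite /zsum; ring.
Qed.

Lemma near_geometric_small (R : realType) (a r e : R) :
  0 <= r -> r < 1 -> 0 < e -> \forall n \near \oo, `|a * r ^+ n| < e.
Proof.
move=> r0 r1 e0; have /cvg_geometric : `|r| < 1 by rewrite ger0_norm.
move=> /(_ a) /cvgrPdist_lt /(_ e e0); apply: filterS => n /=.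
by rewrite sub0r normrN.
Qed.

(** * Convergence of theta-like series *)

(** Since [(|A| |q|^n)^n] bounds [|A|^n |q|^(m n^2)], and its base tends to 0,
    the terms eventually decay faster than [2^-n]. *)
Lemma theta_term_bound (R : realType) (K A q : R[i]) (D : nat -> R[i])
    (m p : nat) : normc q < 1 -> (0 < m)%N ->
  (\forall n \near \oo, 2^-1 <= normc (D n)) ->
  \forall n \near \oo,
    normc (K * A ^+ n * q ^+ (m * n ^ 2) / D n ^+ p)
    <= (normc K * 2 ^+ p) * 2^-1 ^+ n.
Proof.
move=> q1 m0 HD.
have half0 : 0 < 2^-1 :> R by rewrite invr_gt0.
have small := near_geometric_small (normc A) (normc_ge0 q) q1 half0.
near=> n.
rewrite !normcM normcV !normcX.
have Dn : 2^-1 <= normc (D n) by near: n.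
have An : normc A * normc q ^+ n <= 2^-1.
  by apply: le_trans (ler_norm _) _; apply: ltW; near: n.
rewrite -[leLHS]mulrA -mulrA -[leRHS]mulrA ler_wpM2l ?normc_ge0 // mulrA.
rewrite [leRHS]mulrC; apply: ler_pM.
- by rewrite mulr_ge0 // exprn_ge0 // normc_ge0.
- by rewrite invr_ge0 exprn_ge0 // normc_ge0.
- apply: (@le_trans _ _ ((normc A * normc q ^+ n) ^+ n)).
    rewrite exprMn -exprM ler_wpM2l ?exprn_ge0 ?normc_ge0 //.
    by rewrite -mulnn ler_wiXn2l ?normc_ge0 ?ltW // leq_pmull.
  by rewrite lerXn2r ?nnegrE ?mulr_ge0 ?exprn_ge0 ?normc_ge0 // ltW.
- rewrite -exprVn -[X in _ <= X ^+ _]invrK lerXn2r ?nnegrE ?invr_ge0 ?normc_ge0 //.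
  by rewrite lef_pV2 ?posrE // (lt_le_trans half0).
Unshelve. all: by end_near.
Qed.

Lemma normc_sub (R : rcfType) (x y : R[i]) : normc x - normc y <= normc (x + y).
Proof.
rewrite lerBlDr -(normcN y); have := le_normcD (x + y) (- y).
by rewrite addrK.
Qed.

(** The denominators stay away from 0 at both ends: [q ^ j] tends to 0 for
    [j] tending to [+oo] and to infinity for [j] tending to [-oo]. *)
Lemma theta_summable (R : realType) (K A q w : R[i]) (m p : nat) :
  A != 0 -> q != 0 -> w != 0 -> normc q < 1 -> (0 < m)%N ->
  zsummable (fun j : int =>
    K * A ^ j * q ^ (m%:Z * j ^+ 2) / (1 + w * q ^ j) ^+ p).
Proof.
move=> A0 q0 w0 q1 m0; split.
- apply: (@cvg_csum_half_bounded _ _ (normc K * 2 ^+ p)).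
  apply: (@theta_term_bound _ K A q (fun n => 1 + w * q ^ n%:Z)) => //.
  have half0 : 0 < 2^-1 :> R by rewrite invr_gt0.
  have := near_geometric_small (normc w) (normc_ge0 q) q1 half0.
  apply: filterS => n /= Hn.
  have := normc_sub 1 (w * q ^+ n); rewrite normc1 normcM normcX.
  by move: (ler_norm (normc w * normc q ^+ n)); lra.
- have := @theta_term_bound _ K A^-1 q (fun n => 1 + w * q ^ (- n%:Z)) m p q1 m0.
  case; last first.
    move=> N _ HN; apply: (@cvg_csum_half_bounded _ _ (normc K * 2 ^+ p)).
    (* The negative half starts at the index -1: its n-th term is bounded at
       n.+1. *)
    exists N => // n /= Nn; have /= := HN n.+1 (leqW Nn).
    have -> : m%:Z * (- n.+1%:Z) ^+ 2 = (m * n.+1 ^ 2)%N by rewrite sqrrN.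
    rewrite -!exprnN -(exprVn A).
    move=> /le_trans; apply; rewrite ler_wpM2l ?mulr_ge0 ?normc_ge0 //.
    by rewrite exprS ler_piMl ?exprn_ge0 ?invr_ge0 // invf_le1 ?ler1n.
  have e0 : 0 < normc w / 2 by rewrite divr_gt0 ?normc_gt0.
  have := near_geometric_small 1 (normc_ge0 q) q1 e0.
  apply: filterS => n /=; rewrite mul1r => Hn.
  have := normc_sub (w * q ^ (- n%:Z)) 1.
  rewrite normc1 normcM -exprnN normcV normcX [1 + _]addrC.
  have qn0 : 0 < normc q ^+ n by rewrite exprn_gt0 ?normc_gt0.
  have : 2 <= normc w / normc q ^+ n.
    rewrite ler_pdivlMr //; move: (ler_norm (normc q ^+ n)); lra.
  lra.
Qed.

(** * The numerators of L(Lambda^(m,m2)) as Appell functions *)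

Lemma transl_theta_coords (R : realType) (tau z1 z2 t a : R[i]) :
  transl (- (a *: theta)) (coords tau z1 z2 t) =
  coords tau (z1 - a * tau) (z2 + a * tau)
    (t - a * (z1 - z2) + a ^+ 2 * tau).
Proof.
rewrite /transl /coords /Defs.point /fin_vec /theta /delta /alpha3 /Lambda0.
rewrite /alpha0 /alpha1 /alpha2 !(vec_add, vec_scale, vec_opp, formE).
by congr vec; field.
Qed.

Lemma r_theta_coords (R : realType) (tau z1 z2 t : R[i]) :
  r_theta (coords tau z1 z2 t) = coords tau z2 z1 t.
Proof.
rewrite /r_theta /coords /Defs.point /fin_vec /theta /delta /alpha3 /Lambda0.
rewrite /alpha0 /alpha1 /alpha2 !(vec_add, vec_scale, vec_opp, formE).
by congr vec; field.
Qed.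

Lemma Fterm_coords (R : realType) (s : chsign) (m m2 : nat)
    (tau z1 z2 t : R[i]) :
  Fterm s m m2 (coords tau z1 z2 t) =
  ee (m%:R * t - (m2%:R - 1) * z1) / (1 + sg s * ee z1) ^+ 2.
Proof.
have [_ _ e1 _ _] := coordsE tau z1 z2 t.
rewrite /Fterm !e1 expr2; congr (_ / _).
rewrite /expw /ee /Lam /rho /coords /Defs.point /fin_vec /delta /alpha3 /Lambda0.
rewrite /alpha0 /alpha1 /alpha2 !(vec_add, vec_scale, vec_opp, formE).
by congr cexp; field.
Qed.

(** The shape shared by the terms of [Fsum] ([p = 2]) and of [Phi1]
    ([p = 1]). *)
Lemma ee_theta_summable (R : realType) (s : chsign) (m p : nat)
    (tau z x y : R[i]) : 0 < complex.Im tau -> (0 < m)%N ->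
  zsummable (fun j : int =>
    ee (x + j%:~R * y + m%:R * j%:~R ^+ 2 * tau)
    / (1 + sg s * ee (z + j%:~R * tau)) ^+ p).
Proof.
move=> tau_gt0 m0.
have q1 : normc (ee tau) < 1.
  by rewrite normc_ee expR_lt1 oppr_lt0 !mulr_gt0 // pi_gt0.
have w0 : sg s * ee z != 0.
  by rewrite mulf_neq0 ?ee_neq0 //; case: s; rewrite /= ?oppr_eq0 oner_eq0.
have := theta_summable (ee x) p (ee_neq0 y) (ee_neq0 tau) w0 q1 m0.
congr zsummable; apply/funext => j; rewrite -!ee_int -!eeD.
congr (ee _ / (1 + _) ^+ p); last by rewrite eeD mulrA [tau * _]mulrC.
by rewrite rmorphM rmorphXn /=; ring.
Qed.

(** The summation index is reversed with respect to the definition of [Fsum],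
    so that it is the index of [Phi1]. *)
Lemma FsumE (R : realType) (s : chsign) (m m2 : nat) (tau z1 z2 t : R[i]) :
  0 < complex.Im tau -> (0 < m)%N ->
  let u := fun j : int =>
    ee (m%:R * t - (m2%:R - 1) * z1
        + j%:~R * (m%:R * (z1 - z2) - (m2%:R - 1) * tau)
        + m%:R * j%:~R ^+ 2 * tau) / (1 + sg s * ee (z1 + j%:~R * tau)) ^+ 2 in
  zsummable u /\ Fsum s m m2 (coords tau z1 z2 t) = zsum u.
Proof.
move=> tau_gt0 m0 u.
have su : zsummable u by exact: ee_theta_summable.
split=> //; rewrite -(zsum_opp su) /Fsum; congr zsum; apply/funext => j.
rewrite transl_theta_coords Fterm_coords /u mulrNz.
congr (ee _ / (1 + _ * ee _) ^+ 2); ring.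
Qed.

(** The shift of the arguments by [eps s] multiplies the terms of [Phi1] by
    [ee (- m2%:R * eps s)]; with [csign s m2] in front, only the sign [sg s]
    remains, the one that [Fsum_ddot] produces. *)
Lemma csign_eps (R : realType) (s : chsign) (m2 : nat) :
  csign s m2 * ee (- m2%:R * eps s) = sg s :> R[i].
Proof.
case: s => /=; last by rewrite mulr0 ee0 mulr1.
rewrite mulNr [m2%:R * _]mulrC eeN ee_nat ee_half.
by rewrite mulfV // signr_eq0.
Qed.

Lemma sg_eps (R : realType) (s : chsign) : ee (eps s) = - sg s :> R[i].
Proof. by case: s => /=; rewrite ?ee_half ?ee0 ?opprK. Qed.

Lemma sg2 (R : realType) (s : chsign) : sg s * sg s = 1 :> R[i].
Proof. by case: s => /=; rewrite ?mulrNN mulr1. Qed.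

(** Passing from [m2] to [m2.+1] divides the [j]-th numerator by
    [ee w], where [w = z1 + j tau]. Hence the two terms add up to
    [(ee w + sg s) / (1 + sg s * ee w) ^+ 2], times a common factor, and one of
    the two linear factors of the denominator cancels. The sign [sg s] in
    front of [ee w] is then absorbed in the shift by [eps s]. *)
Lemma Fsum_ddot (R : realType) (s : chsign) (m m2 : nat)
    (tau z1 z2 t : R[i]) : 0 < complex.Im tau -> (0 < m)%N ->
  Fsum s m m2 (coords tau z1 z2 t)
  + sg s * Fsum s m m2.+1 (coords tau z1 z2 t) =
  csign s m2 * ee (m%:R * t) *
  Phi1 m%:R (- m2%:R) tau (z1 + eps s) (- z2 - eps s) 0.
Proof.
move=> tau_gt0 m0.
have [s1 ->] := FsumE s m2 z1 z2 t tau_gt0 m0.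
have [s2 ->] := FsumE s m2.+1 z1 z2 t tau_gt0 m0.
rewrite -zsum_linear // /Phi1 mulr0 oppr0 ee0 mul1r.
set v := (X in _ = _ * zsum X).
have vE j : v j = ee (- m2%:R * (z1 + eps s)
     + j%:~R * (m%:R * (z1 - z2) - m2%:R * tau) + m%:R * j%:~R ^+ 2 * tau)
     / (1 + sg s * ee (z1 + j%:~R * tau)) ^+ 1.
  rewrite /v /qpow expr1 -!eeD; congr (ee _ / (1 + _)); first by ring.
  rewrite -[sg s]opprK -sg_eps mulNr -eeD; congr (- ee _); ring.
have sv : zsummable v.
  by rewrite (funext vE); exact: ee_theta_summable.
rewrite -zsumZ //; congr zsum; apply/funext => j; rewrite vE.
set w := z1 + j%:~R * tau; set E := ee (m%:R * t - m2%:R * w +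
  j%:~R * (m%:R * (z1 - z2)) + m%:R * j%:~R ^+ 2 * tau).
have -> : ee (m%:R * t - (m2%:R - 1) * z1
    + j%:~R * (m%:R * (z1 - z2) - (m2%:R - 1) * tau)
    + m%:R * j%:~R ^+ 2 * tau) = E * ee w.
  by rewrite -eeD; congr ee; rewrite /w; ring.
have -> : ee (m%:R * t - (m2.+1%:R - 1) * z1
    + j%:~R * (m%:R * (z1 - z2) - (m2.+1%:R - 1) * tau)
    + m%:R * j%:~R ^+ 2 * tau) = E.
  by congr ee; rewrite /w -natr1; ring.
have -> : ee (- m2%:R * (z1 + eps s)
     + j%:~R * (m%:R * (z1 - z2) - m2%:R * tau) + m%:R * j%:~R ^+ 2 * tau)
   = ee (- m2%:R * eps s) * (ee (- (m%:R * t)) * E).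
  by rewrite -!eeD; congr ee; rewrite /w; ring.
have -> : csign s m2 * ee (m%:R * t) * (ee (- m2%:R * eps s) *
     (ee (- (m%:R * t)) * E) / (1 + sg s * ee w) ^+ 1)
   = sg s * E / (1 + sg s * ee w).
  rewrite expr1.
  transitivity (csign s m2 * ee (- m2%:R * eps s) *
    (ee (- (m%:R * t)) * ee (m%:R * t)) * E / (1 + sg s * ee w)); first by ring.
  by rewrite csign_eps eeK mulr1.
(* At a pole both sides are 0, the value of a quotient by 0. *)
have [w0|w0] := eqVneq (1 + sg s * ee w) 0.
  by rewrite w0 expr0n /= invr0; ring.
have g2 := sg2 R s; field: g2.
exact: w0.
Qed.

(** The second half of [Phi] is the image of the first one by the exchange of
    [z1] and [z2] in the points [(z1, - z2)]; on the Cartan subalgebra that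
    exchange is [r_theta]. *)
Lemma Phi2_Phi1 (R : realType) (m s tau z1 z2 : R[i]) :
  Phi2 m s tau z1 z2 0 = Phi1 m s tau (- z2) (- z1) 0.
Proof.
rewrite /Phi1 /Phi2; congr (_ * zsum _); apply/funext => j.
by congr (ee _ * _ / _); ring.
Qed.

Lemma numer_ddot (R : realType) (s : chsign) (m m2 : nat)
    (tau z1 z2 t : R[i]) : 0 < complex.Im tau -> (0 < m)%N ->
  numer s m m2 (coords tau z1 z2 t)
  + sg s * numer s m m2.+1 (coords tau z1 z2 t) =
  csign s m2 * ee (m%:R * t) *
  Phi m%:R (- m2%:R) tau (z1 + eps s) (- z2 - eps s) 0.
Proof.
move=> tau_gt0 m0; rewrite /numer r_theta_coords /Phi Phi2_Phi1.
have -> : - (- z2 - eps s) = z2 + eps s by ring.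
have -> : - (z1 + eps s) = - z1 - eps s by ring.
rewrite [RHS]mulrBr -!Fsum_ddot //.
move: (Fsum _ _ _ _) (Fsum _ _ _ _) (Fsum _ _ _ _) (Fsum _ _ _ _) => a b c d.
ring.
Qed.

(** * Principal admissible weights *)

(** The action of the inverse of [ybar ty] on the finite part. In these
    coordinates the four types differ by nothing else. *)
Definition ybar_coords (R : realType) (ty : adm_type) (z1 z2 : R[i]) :
  R[i] * R[i] :=
  match ty with
  | TypeI => (z1, z2)
  | TypeII => (- z1, - z2)
  | TypeIII => (- z2, - z1)
  | TypeIV => (z2, z1)
  end.

Lemma fin_vecD (R : realType) (a z1 z2 b1 b2 : R[i]) :
  fin_vec z1 z2 + a *: fin_vec b1 b2 = fin_vec (z1 + a * b1) (z2 + a * b2).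
Proof.
rewrite /fin_vec /alpha3 /alpha1 /alpha2 !(vec_add, vec_scale, vec_opp).
by congr vec; field.
Qed.

Lemma form_fin_vec (R : realType) (a1 a2 b1 b2 : R[i]) :
  Defs.form (fin_vec a1 a2) (fin_vec b1 b2) = - (a1 * b2 + a2 * b1).
Proof.
rewrite /fin_vec /alpha3 /alpha1 /alpha2.
rewrite !(vec_add, vec_scale, vec_opp, formE).
by field.
Qed.

Lemma r_theta_fin_vec (R : realType) (z1 z2 : R[i]) :
  r_theta (fin_vec z1 z2) = fin_vec z2 z1.
Proof.
rewrite /r_theta /fin_vec /theta /alpha3 /alpha1 /alpha2.
rewrite !(vec_add, vec_scale, vec_opp, formE).
by congr vec; field.
Qed.

Lemma r_alpha2_fin_vec (R : realType) (z1 z2 : R[i]) :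
  r_alpha2 (fin_vec z1 z2) = fin_vec (- z2) (- z1).
Proof.
rewrite /r_alpha2 /fin_vec /alpha3 /alpha1 /alpha2.
rewrite !(vec_add, vec_scale, vec_opp, formE).
by congr vec; field.
Qed.

(** The vector [ybar_inv (beta)] has coordinates [(k1, - (k1 + k2))] for all
    four types, and the form is invariant. *)
Lemma adm_point_coords (R : realType) (ty : adm_type) (M k1 k2 : nat)
    (tau z1 z2 t : R[i]) (x := ybar_coords ty z1 z2) :
  adm_point ty M k1 k2 tau (fin_vec z1 z2) t =
  coords (M%:R * tau) (x.1 + k1%:R * tau) (x.2 - (k1%:R + k2%:R) * tau)
    (M%:R^-1 * (t + (k1%:R + k2%:R) * x.1 - k1%:R * x.2
      + k1%:R * (k1%:R + k2%:R) * tau)).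
Proof.
have eq_point T a b u a' b' u' : a = a' -> b = b' -> u = u' ->
    Defs.point T (fin_vec a b) u = coords T a' b' u' :> cartan R.
  by move=> -> -> ->.
rewrite /adm_point /x; case: ty {x} => /=; rewrite !form_fin_vec fin_vecD.
- apply: eq_point; rewrite -?mulrA; [ring | ring | congr (_ * _); by field].
- rewrite r_theta_fin_vec r_alpha2_fin_vec.
  apply: eq_point; rewrite -?mulrA; [ring | ring | congr (_ * _); by field].
- rewrite r_alpha2_fin_vec; apply: eq_point; rewrite -?mulrA; [ring | ring | congr (_ * _); by field].
- rewrite r_theta_fin_vec; apply: eq_point; rewrite -?mulrA; [ring | ring | congr (_ * _); by field].
Qed.

(** The walls of a root and of its opposite are the same. *)
Lemma one_add_ee_neq0N (R : realType) (a x : R[i]) : a * a = 1 ->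
  1 + a * ee x != 0 -> 1 + a * ee (- x) != 0.
Proof.
move=> a2; apply: contra => /eqP h; apply/eqP.
have -> : 1 + a * ee x = (a * ee x) * (1 + a * ee (- x)).
  transitivity (a * ee x + (a * a) * (ee (- x) * ee x)); last by ring.
  by rewrite a2 eeK; ring.
by rewrite h mulr0.
Qed.

Lemma Re_form_delta_coords (R : realType) (tau z1 z2 t : R[i]) :
  complex.Re (Defs.form delta (coords tau z1 z2 t)) =
  2 * pi * complex.Im tau.
Proof.
have -> : Defs.form delta (coords tau z1 z2 t) = - (twopii * tau).
  rewrite /coords /Defs.point /fin_vec /delta /alpha3 /Lambda0.
  rewrite /alpha0 /alpha1 /alpha2 !(vec_add, vec_scale, vec_opp, formE).
  by field.
by case: tau => a b; rewrite /twopii /=; ring.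
Qed.

(** The conditions of [regular] on the real roots, with a sign chosen for each
    root so that the two odd conditions have the same form. *)
Definition off_walls (R : realType) (s : chsign) (tau z1 z2 : R[i]) : Prop :=
  forall n : int,
    [/\ 1 + -1 * ee (z1 + z2 + n%:~R * tau) != 0,
        1 + -1 * ee (z1 - z2 + n%:~R * tau) != 0,
        1 + sg s * ee (z1 + n%:~R * tau) != 0 &
        1 + sg s * ee (z2 + n%:~R * tau) != 0].

Lemma regular_coords (R : realType) (s : chsign) (tau z1 z2 t : R[i]) :
  regular s (coords tau z1 z2 t) <->
  0 < complex.Im tau /\ off_walls s tau z1 z2.
Proof.
rewrite /regular Re_form_delta_coords pmulr_rgt0 ?mulr_gt0 ?pi_gt0 //.
have E (n : int) : [/\
  expw (- (alpha2 + n%:~R *: delta)) (coords tau z1 z2 t) =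
    ee (- (z1 + z2 - n%:~R * tau)),
  expw (- (theta + n%:~R *: delta)) (coords tau z1 z2 t) =
    ee (z1 - z2 + n%:~R * tau),
  expw (- (alpha1 + n%:~R *: delta)) (coords tau z1 z2 t) =
    ee (z1 + n%:~R * tau) &
  expw (- (alpha1 + alpha2 + n%:~R *: delta)) (coords tau z1 z2 t) =
    ee (- (z2 - n%:~R * tau))].
  rewrite /expw /ee /theta /coords /Defs.point /fin_vec /delta /alpha3 /Lambda0.
  rewrite /alpha0 /alpha1 /alpha2 !(vec_add, vec_scale, vec_opp, formE).
  by split; congr cexp; field.
have n11 : -1 * -1 = 1 :> R[i] by rewrite mulrNN mulr1.
have N (x : R[i]) : 1 - ee x != 0 -> 1 - ee (- x) != 0.
  by have := @one_add_ee_neq0N R _ x n11; rewrite !mulN1r.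
have s2 := sg2 R s.
(* The roots alpha2 + n delta and alpha1 + alpha2 + n delta correspond to the
   index - n of [off_walls], after a change of sign. *)
split=> -[tau_gt0 H]; split=> // n.
- have [e1 e2 e3 e4] := E n; have [e1' e2' e3' e4'] := E (- n).
  have [_ + + _] := H n; have [+ _ _ +] := H (- n).
  rewrite e1' e2 e3 e4' mulrNz !mulNr !opprK !mul1r => h1 h4 h2 h3.
  split=> //.
  + by rewrite -[_ + _ * _]opprK; apply: N.
  + by rewrite -[z2 + _]opprK; apply: one_add_ee_neq0N.
- have [e1 e2 e3 e4] := E n.
  have [_ + + _] := H n; have [+ _ _ +] := H (- n).
  rewrite e1 e2 e3 e4 mulrNz !mulNr !mul1r => h1 h4 h2 h3.
  split=> //; last exact: one_add_ee_neq0N.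
  exact: N.
Qed.

(** The finite Weyl group permutes the walls; it is generated by the exchange
    of the coordinates and the change of their signs. *)
Lemma off_walls_ybar (R : realType) (s : chsign) (ty : adm_type)
    (tau z1 z2 : R[i]) (x := ybar_coords ty z1 z2) :
  off_walls s tau z1 z2 -> off_walls s tau x.1 x.2.
Proof.
have n11 : -1 * -1 = 1 :> R[i] by rewrite mulrNN mulr1.
have swap y1 y2 : off_walls s tau y1 y2 -> off_walls s tau y2 y1.
  move=> H n; have [h1 _ h3 h4] := H n; have [_ h2 _ _] := H (- n).
  split=> //; first by rewrite [y2 + _]addrC.
  have -> : y2 - y1 + n%:~R * tau = - (y1 - y2 + (- n)%:~R * tau).
    by rewrite mulrNz; ring.
  exact: one_add_ee_neq0N.
have neg y1 y2 : off_walls s tau y1 y2 -> off_walls s tau (- y1) (- y2).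
  move=> H n; have [h1 h2 h3 h4] := H (- n).
  have N (y : R[i]) : - y + n%:~R * tau = - (y + (- n)%:~R * tau).
    by rewrite mulrNz; ring.
  by rewrite -!opprD !N; split; apply: one_add_ee_neq0N; rewrite ?sg2.
by rewrite /x; case: ty {x} => //= H; [exact: neg | exact/neg/swap | exact: swap].
Qed.

(** Integral multiples of [tau] only shift the index of a wall, and the walls
    for [M * tau] are among those for [tau]. *)
Lemma off_walls_shift (R : realType) (s : chsign) (M k1 k2 : int)
    (tau z1 z2 : R[i]) : off_walls s tau z1 z2 ->
  off_walls s (M%:~R * tau) (z1 + k1%:~R * tau) (z2 + k2%:~R * tau).
Proof.
move=> H n; have [h1 _ _ _] := H (k1 + k2 + n * M).
have [_ h2 _ _] := H (k1 - k2 + n * M).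
have [_ _ h3 _] := H (k1 + n * M); have [_ _ _ h4] := H (k2 + n * M).
move: h1 h2 h3 h4; rewrite !rmorphD rmorphN !rmorphM /= => h1 h2 h3 h4.
split; [move: h1 | move: h2 | move: h3 | move: h4];
  by congr (~~ (1 + _ * ee _ == 0)); ring.
Qed.

(** The formula for the numerators of L(Lambda^(m,m2)) is available at regular
    points only, and is to be used at [adm_point]. *)
Lemma regular_adm_point (R : realType) (s : chsign) (ty : adm_type)
    (M k1 k2 : nat) (tau z1 z2 t : R[i]) : (0 < M)%N ->
  regular s (coords tau z1 z2 t) ->
  regular s (adm_point ty M k1 k2 tau (fin_vec z1 z2) t).
Proof.
move=> M0 /regular_coords[tau_gt0 /(off_walls_ybar ty) H].
rewrite adm_point_coords; apply/regular_coords; split.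
  rewrite mulr_natl (raddfMn (@complex.Im R : Rcomplex R -> R)).
  by rewrite pmulrn_lgt0.
have := off_walls_shift M k1 (- (k1%:Z + k2%:Z)) H.
by rewrite mulrNz mulrzDr mulNr.
Qed.

(** * The four types, untwisted and twisted *)

(** The formulas of the four types, read in the coordinates [x]. *)
Lemma numer_ch_ddot (R : realType)
    (Den : chsign -> cartan R -> R[i])
    (ch : chsign -> cartan R -> cartan R -> R[i])
    (hch : character_formulas Den ch)
    (M m m2 : nat) (ty : adm_type) (k1 k2 : nat) (s : chsign)
    (tau z1 z2 t : R[i]) (x := ybar_coords ty z1 z2) :
  (0 < M)%N -> (0 < m)%N -> coprime M m -> (m2 <= m - 1)%N ->
  admissible ty M k1 k2 -> regular s (coords tau z1 z2 t) ->
  Den s (coords tau z1 z2 t) * ch_ddot ch s ty M m m2 k1 k2 (coords tau z1 z2 t)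
  = csign s m2
    * ee (m%:R / M%:R * (t + (k1%:R + k2%:R) * x.1 - k1%:R * x.2
                         + k1%:R * (k1%:R + k2%:R) * tau))
    * Phi m%:R (- m2%:R) (M%:R * tau) (x.1 + k1%:R * tau + eps s)
        (- x.2 + (k1%:R + k2%:R) * tau - eps s) 0.
Proof.
move=> M0 m0 Mm m2m hk reg; case: hch => hnum hadm.
have m2m' : (m2.+1 <= m)%N by rewrite -(subnK m0) addn1 ltnS.
have reg' := regular_adm_point ty k1 k2 M0 reg.
have step n2 : (n2 <= m)%N ->
    Den s (coords tau z1 z2 t)
      * ch s (adm_weight ty M m n2 k1 k2) (coords tau z1 z2 t)
    = numer s m n2 (adm_point ty M k1 k2 tau (fin_vec z1 z2) t).
  by move=> n2m; rewrite -(hnum s m n2 _ m0 n2m reg'); exact: hadm.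
have E0 := step _ (ltnW m2m'); have E1 := step _ m2m'.
have comb (d a b n0 n1 : R[i]) : d * a = n0 -> d * b = n1 ->
    d * (a + sg s * b) = n0 + sg s * n1 by move=> <- <-; ring.
rewrite (comb _ _ _ _ _ E0 E1); move: reg'; rewrite adm_point_coords.
move=> /regular_coords[tau_gt0 _].
rewrite numer_ddot // -/x opprB; congr (_ * ee _ * Phi _ _ _ _ _ _).
- by ring.
- by ring.
Qed.

Theorem proposition4p4 (R : realType)
    (Den : chsign -> cartan R -> R[i])
    (ch : chsign -> cartan R -> cartan R -> R[i])
    (hch : character_formulas Den ch)
    (M m : nat) (hM : (0 < M)%N) (hm : (0 < m)%N) (hMm : coprime M m)
    (m2 : nat) (hm2 : (m2 <= m - 1)%N)
    (ty : adm_type) (k1 k2 : nat) (hk : admissible ty M k1 k2)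
    (s : chsign) (tau z1 z2 t : R[i]) :
  let N := fun h => Den s h * ch_ddot ch s ty M m m2 k1 k2 h in
  let Ntw := fun h => tw (Den s) h * ch_ddot_tw ch s ty M m m2 k1 k2 h in
  let c : R[i] := csign s m2 in
  let e : R[i] := eps s in
  let l : R[i] := m%:R / M%:R in
  let K1 : R[i] := k1%:R in
  let K2 : R[i] := k2%:R in
  let P := Phi (m%:R : R[i]) (- m2%:R) (M%:R * tau) in
  let h := coords tau z1 z2 t in
  (regular s h ->
   N h =
   match ty with
   | TypeI =>
       c * ee (l * (t + (K1 + K2) * z1 - K1 * z2))
       * qpow tau (l * (K1 * (K1 + K2)))
       * P (z1 + K1 * tau + e) (- z2 + (K1 + K2) * tau - e) 0
   | TypeII =>
       c * ee (l * (t - (K1 + K2) * z1 + K1 * z2))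
       * qpow tau (l * (K1 * (K1 + K2)))
       * P (- z1 + K1 * tau + e) (z2 + (K1 + K2) * tau - e) 0
   | TypeIII =>
       c * ee (l * (t - (K1 + K2) * z2 + K1 * z1))
       * qpow tau (l * (K1 * (K1 + K2)))
       * P (- z2 + K1 * tau + e) (z1 + (K1 + K2) * tau - e) 0
   | TypeIV =>
       c * ee (l * (t + (K1 + K2) * z2 - K1 * z1))
       * qpow tau (l * (K1 * (K1 + K2)))
       * P (z2 + K1 * tau + e) (- z1 + (K1 + K2) * tau - e) 0
   end) /\
  (regular s (w0 h) ->
   Ntw h =
   match ty with
   | TypeI =>
       c * ee (l * (t - tau / 4))
       * ee (l * ((K1 + 1 / 2) * z1 - (K1 + K2 - 1 / 2) * z2))
       * qpow tau (l * (K1 * (K1 + K2) + 1 / 2 * K2))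
       * P (- z2 + (K1 + 1 / 2) * tau + e)
           (z1 + (K1 + K2 - 1 / 2) * tau - e) 0
   | TypeII =>
       c * ee (l * (t - tau / 4))
       * ee (l * (- ((K1 - 1 / 2) * z1) + (K1 + K2 + 1 / 2) * z2))
       * qpow tau (l * (K1 * (K1 + K2) - 1 / 2 * K2))
       * P (z2 + (K1 - 1 / 2) * tau + e)
           (- z1 + (K1 + K2 + 1 / 2) * tau - e) 0
   | TypeIII =>
       c * ee (l * (t - tau / 4))
       * ee (l * ((K1 + K2 + 1 / 2) * z1 - (K1 - 1 / 2) * z2))
       * qpow tau (l * (K1 * (K1 + K2) - 1 / 2 * K2))
       * P (z1 + (K1 - 1 / 2) * tau + e)
           (- z2 + (K1 + K2 + 1 / 2) * tau - e) 0
   | TypeIV =>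
       c * ee (l * (t - tau / 4))
       * ee (l * (- ((K1 + K2 - 1 / 2) * z1) + (K1 + 1 / 2) * z2))
       * qpow tau (l * (K1 * (K1 + K2) + 1 / 2 * K2))
       * P (- z1 + (K1 + 1 / 2) * tau + e)
           (z2 + (K1 + K2 - 1 / 2) * tau - e) 0
   end).
Proof.
move=> N Ntw c e l K1 K2 P h.
have NE (w1 w2 w3 : R[i]) (x := ybar_coords ty w1 w2) :
    regular s (coords tau w1 w2 w3) ->
    N (coords tau w1 w2 w3) =
    c * ee (l * (w3 + (K1 + K2) * x.1 - K1 * x.2 + K1 * (K1 + K2) * tau))
    * P (x.1 + K1 * tau + e) (- x.2 + (K1 + K2) * tau - e) 0.
  exact: numer_ch_ddot.
(* Twisting is evaluation at [w0 h], so that the twisted formulas are the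
   untwisted ones at the point given by [w0_coords]. *)
have NtwE : Ntw h = N (w0 h) by [].
clearbody c e l K1 K2 P; split=> reg.
  rewrite NE // {NE NtwE} /qpow; case: {N Ntw hk} ty => /=;
    rewrite -[c * ee _ * ee _]mulrA -eeD;
    congr (_ * ee _ * P _ _ _); ring.
rewrite NtwE w0_coords NE -?w0_coords // {NE NtwE} /qpow.
case: {N Ntw hk} ty => /=;
  rewrite -[c * ee _ * ee _]mulrA -eeD -[c * ee _ * ee _]mulrA -eeD;
  congr (_ * ee _ * P _ _ _); by field.
Qed.
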